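(* Let $n\ge 2$ and let $(X,F)$ be a symmetric $n$-ary band, written as a strong $n$-ary semilattice $(X,F)=[Y,(X_\alpha,F_\alpha),\varphi_{\alpha,\beta}]$ of $n$-ary extensions $(X_\alpha,F_\alpha)$ of Abelian groups whose exponents divide $n-1$. Then $(X,F)$ is reducible to a semigroup if and only if there exists a map $e\colon Y\to X$ such that (i) for every $\alpha\in Y$, $e(\alpha)=e_\alpha$ belongs to $X_\alpha$; (ii) for every $\alpha,\beta\in Y$ such that $\alpha\geq\beta$, we have $\varphi_{\alpha,\beta}(e_\alpha)=e_\beta$. Moreover, when $(X,F)$ is reducible to a semigroup (and $e$ is a map satisfying (i) and (ii)), a reduction is given by the semigroup decomposed as the strong semilattice of semigroups $[Y,(X_\alpha,G_\alpha),\varphi_{\alpha,\beta}]$, where $G_\alpha$ is the reduction of $F_\alpha$ with respect to $e_\alpha$, i.e. $G_\alpha(x,y)=F_\alpha(x,e_\alpha,\ldots,e_\alpha,y)$ with $e_\alpha$ repeated $n-2$ times.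
   Context: An operation $F\colon X^n\to X$ ($X$ nonempty) is associative if $F(x_1,\ldots,x_{i-1},F(x_i,\ldots,x_{i+n-1}),x_{i+n},\ldots,x_{2n-1})=F(x_1,\ldots,x_i,F(x_{i+1},\ldots,x_{i+n}),x_{i+n+1},\ldots,x_{2n-1})$ for all $x_1,\ldots,x_{2n-1}\in X$ and $1\le i\le n-1$; then $(X,F)$ is an $n$-ary semigroup. A symmetric $n$-ary band is an $n$-ary semigroup $(X,F)$ with $F$ invariant under permutations of its arguments and idempotent ($F(x,\ldots,x)=x$ for all $x$). A homomorphism of $n$-ary groupoids is a map commuting with the $n$-ary operations. The $n$-ary extension of a semigroup $(X,\ast)$ is $(X,F)$ with $F(x_1,\ldots,x_n)=x_1\ast\cdots\ast x_n$; in this case $F$ is said to be reducible to (the semigroup operation) $\ast$, and $\ast$ is called a (binary) reduction of $F$. A semilattice $(Y,\wedge)$ is a commutative idempotent semigroup, ordered by $\alpha\ge\beta\iff\alpha\wedge\beta=\beta$; its $n$-ary extension is denoted $\wedge^{n-1}$. The exponent of a group divides $n-1$ means $x^{n-1}$ is the neutral element for every $x$. $(X,F)=[Y,(X_\alpha,F_\alpha),\varphi_{\alpha,\beta}]$ is a strong $n$-ary semilattice of $n$-ary semigroups $(X_\alpha,F_\alpha)$ means: $(Y,\wedge)$ is a semilattice, $X$ is the disjoint union of nonempty subsets $X_\alpha$ ($\alpha\in Y$), $F(X_{\alpha_1}\times\cdots\times X_{\alpha_n})\subseteq X_{\alpha_1\wedge\cdots\wedge\alpha_n}$, $F_\alpha=F|_{X_\alpha^n}$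 is an $n$-ary semigroup operation on $X_\alpha$, and for all $\alpha\ge\beta$ in $Y$ there is given a homomorphism $\varphi_{\alpha,\beta}\colon (X_\alpha,F_\alpha)\to(X_\beta,F_\beta)$ such that (a) $\varphi_{\alpha,\alpha}=\mathrm{id}_{X_\alpha}$; (b) $\varphi_{\beta,\gamma}\circ\varphi_{\alpha,\beta}=\varphi_{\alpha,\gamma}$ for $\alpha\ge\beta\ge\gamma$; (c) for $x_i\in X_{\alpha_i}$ and $\alpha=\alpha_1\wedge\cdots\wedge\alpha_n$, $F(x_1,\ldots,x_n)=F_\alpha(\varphi_{\alpha_1,\alpha}(x_1),\ldots,\varphi_{\alpha_n,\alpha}(x_n))$. Every symmetric $n$-ary band has such a decomposition in which each $(X_\alpha,F_\alpha)$ is the $n$-ary extension of an Abelian group whose exponent divides $n-1$. The (binary) strong semilattice of semigroups $[Y,(X_\alpha,G_\alpha),\varphi_{\alpha,\beta}]$, where the $\varphi_{\alpha,\beta}\colon(X_\alpha,G_\alpha)\to(X_\beta,G_\beta)$ ($\alpha\ge\beta$) are semigroup homomorphisms satisfying (a) and (b), is the semigroup $(X,G)$ with $G(x,y)=G_{\alpha\wedge\beta}(\varphi_{\alpha,\alpha\wedge\beta}(x),\varphi_{\beta,\alpha\wedge\beta}(y))$ for $x\in X_\alpha$, $y\in X_\beta$. *)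

(* Defs.v *)
From mathcomp Require Import all_boot all_order all_fingroup.
From mathcomp Require Import boolp classical_sets functions.

Set Implicit Arguments.
Unset Strict Implicit.
Unset Printing Implicit Defensive.

Import Order.TTheory.
Local Open Scope classical_set_scope.

(* An n-ary operation on X is a map F : n.-tuple X -> X, and a binary operation
   a map op : X -> X -> X. Notions relative to A : set X concern the structure
   with carrier A whose operation is the restriction of F (resp. op) to A. *)

Definition entries_in (X : Type) (n : nat) (A : set X) (x : n.-tuple X) : Prop :=
  forall i, A (tnth x i).

Definition nary_closed (X : Type) (n : nat) (A : set X) (F : n.-tuple X -> X) : Prop :=
  forall x, entries_in A x -> A (F x).

(* F(x_0,...,x_(i-1), F(x_i,...,x_(i+n-1)), x_(i+n),...,x_(2n-2)), with 0-based
   indices; for i < n only the first 2n-1 terms of the sequence x are used. *)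
Definition nested_at (X : Type) (n : nat) (F : n.-tuple X -> X)
    (x : nat -> X) (i : nat) : X :=
  F [tuple if j < i then x j
           else if j == i :> nat then F [tuple x (i + k) | k < n]
           else x (j + n.-1) | j < n].

Definition nary_associative (X : Type) (n : nat) (A : set X)
    (F : n.-tuple X -> X) : Prop :=
  forall x : nat -> X, (forall k, A (x k)) ->
  forall i, i.+1 < n -> nested_at F x i = nested_at F x i.+1.

Definition nary_semigroup (X : Type) (n : nat) (A : set X)
    (F : n.-tuple X -> X) : Prop :=
  [/\ A !=set0, nary_closed A F & nary_associative A F].

Definition nary_symmetric (X : Type) (n : nat) (F : n.-tuple X -> X) : Prop :=
  forall (s : 'S_n) (x : n.-tuple X), F [tuple tnth x (s i) | i < n] = F x.

Definition nary_idempotent (X : Type) (n : nat) (F : n.-tuple X -> X) : Prop :=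
  forall x : X, F [tuple of nseq n x] = x.

Definition symmetric_nary_band (X : Type) (n : nat) (F : n.-tuple X -> X) : Prop :=
  [/\ nary_semigroup setT F, nary_symmetric F & nary_idempotent F].

Definition nary_morphism (X : Type) (n : nat) (A B : set X)
    (F : n.-tuple X -> X) (f : X -> X) : Prop :=
  set_fun A B f /\
  forall x, entries_in A x -> f (F x) = F [tuple of map f x].

Definition semigroup (X : Type) (A : set X) (op : X -> X -> X) : Prop :=
  [/\ A !=set0,
      forall x y, A x -> A y -> A (op x y) &
      forall x y z, A x -> A y -> A z -> op x (op y z) = op (op x y) z].

Definition semigroup_morphism (X : Type) (A B : set X)
    (opA opB : X -> X -> X) (f : X -> X) : Prop :=
  set_fun A B f /\
  forall x y, A x -> A y -> f (opA x y) = opB (f x) (f y).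

(* The product x_1 * ... * x_k of a nonempty sequence, None on the empty one:
   a semigroup has no neutral element to serve as a default. *)
Definition seq_product (X : Type) (op : X -> X -> X) (s : seq X) : option X :=
  if s is x :: r then Some (foldl op x r) else None.

Definition nary_extension (X : Type) (n : nat) (A : set X)
    (op : X -> X -> X) (F : n.-tuple X -> X) : Prop :=
  forall x, entries_in A x -> seq_product op x = Some (F x).

Definition is_reduction (X : Type) (n : nat) (op : X -> X -> X)
    (F : n.-tuple X -> X) : Prop :=
  semigroup setT op /\ nary_extension setT op F.

Definition reducible (X : Type) (n : nat) (F : n.-tuple X -> X) : Prop :=
  exists op : X -> X -> X, is_reduction op F.

Definition abelian_group (X : Type) (A : set X) (op : X -> X -> X) (u : X) : Prop :=
  [/\ semigroup A op,
      forall x y, A x -> A y -> op x y = op y x,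
      A u /\ (forall x, A x -> op u x = x) &
      forall x, A x -> exists2 y, A y & op x y = u].

(* For k > 0; the power x^k is the product of k copies of x. *)
Definition exponent_divides (X : Type) (A : set X) (op : X -> X -> X) (u : X)
    (k : nat) : Prop :=
  forall x, A x -> seq_product op (nseq k x) = Some u.

Definition extension_of_abelian_group_of_exponent_dvd (X : Type) (n : nat)
    (A : set X) (F : n.-tuple X -> X) : Prop :=
  exists op u, [/\ abelian_group A op u, exponent_divides A op u n.-1 &
                   nary_extension A op F].

(* Conditions (a) and (b) on the transition maps; phi a b is only meaningful
   on X_ a and for b <= a. *)
Definition functorial (d : Order.disp_t) (Y : meetSemilatticeType d) (X : Type)
    (X_ : Y -> set X) (phi : Y -> Y -> X -> X) : Prop :=
  (forall a x, X_ a x -> phi a a x = x) /\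
  (forall a b c : Y, (c <= b)%O -> (b <= a)%O ->
     forall x, X_ a x -> phi b c (phi a b x) = phi a c x).

Record strong_nary_semilattice (d : Order.disp_t) (Y : meetSemilatticeType d)
    (X : Type) (n : nat) (X_ : Y -> set X) (phi : Y -> Y -> X -> X)
    (F : n.-tuple X -> X) : Prop := {
  sns_partition : classical_sets.partition setT X_ setT;
  sns_graded : forall (a : n.-tuple Y) (m : Y) (x : n.-tuple X),
    seq_product Order.meet a = Some m ->
    (forall i, X_ (tnth a i) (tnth x i)) -> X_ m (F x);
  sns_semigroup : forall a, nary_semigroup (X_ a) F;
  sns_morphism : forall a b : Y, (b <= a)%O ->
    nary_morphism (X_ a) (X_ b) F (phi a b);
  sns_functorial : functorial X_ phi;
  sns_op : forall (a : n.-tuple Y) (m : Y) (x : n.-tuple X),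
    seq_product Order.meet a = Some m ->
    (forall i, X_ (tnth a i) (tnth x i)) ->
    F x = F [tuple phi (tnth a i) m (tnth x i) | i < n]
}.

Record strong_semilattice (d : Order.disp_t) (Y : meetSemilatticeType d)
    (X : Type) (X_ : Y -> set X) (G_ : Y -> X -> X -> X)
    (phi : Y -> Y -> X -> X) (G : X -> X -> X) : Prop := {
  ss_partition : classical_sets.partition setT X_ setT;
  ss_semigroup : forall a, semigroup (X_ a) (G_ a);
  ss_morphism : forall a b : Y, (b <= a)%O ->
    semigroup_morphism (X_ a) (X_ b) (G_ a) (G_ b) (phi a b);
  ss_functorial : functorial X_ phi;
  ss_op : forall a b x y, X_ a x -> X_ b y ->
    G x y = G_ (Order.meet a b) (phi a (Order.meet a b) x)
                                (phi b (Order.meet a b) y)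
}.

(* F(x, e, ..., e, y) with n - 2 copies of e, for n >= 2. *)
Definition reduction_at (X : Type) (n : nat) (F : n.-tuple X -> X) (e x y : X) : X :=
  F [tuple if i == 0 :> nat then x
           else if i == n.-1 :> nat then y else e | i < n].

(* Main.v *)
Require Import Defs.
From mathcomp Require Import all_boot all_order.
From mathcomp Require Import boolp classical_sets.

(** For an idempotent [e] of a reduction [op] of [F] and any [y], the product
    [F (e, ..., e, y)] is [op e y].

    Suppose [op] reduces [F]. Since [x^n = x], every [x] has an idempotent power
    [x^(n-1)], and the grading of [F] keeps this power in the component of [x]
    ([component_has_idempotent]). So every component contains an idempotent. If
    [e] and [f] are idempotents of [op] in [X_ a] and [X_ b] with [b <= a], then
    [op e f] is both [F (e, ..., e, f)] and [F (e, f, ..., f)]. Transporting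
    these two products to the Abelian group [X_ b], whose exponent divides
    [n - 1], turns the first into [f] and the second into [phi a b e]; hence
    [phi a b e = f] ([transition_idempotent]). An arbitrary choice of one
    idempotent in each component is therefore a compatible section. Comparing
    two idempotents takes the place of any study of how [op] itself interacts
    with the decomposition.

    Conversely, let [e] be a compatible section. In the Abelian group [X_ a],
    the operation [F (x, e, ..., e, y)] is [x e^(-1) y] because
    [e^(n-2) = e^(-1)]. It is associative, and the product of [n] factors picks
    up the extra factor [e^(-(n-1))], which is trivial
    ([reduction_at_extension]). Compatibility of [e] says exactly that the
    transition maps are morphisms for these binary operations, so they glue to
    a strong semilattice of semigroups ([strong_semilattice_exists]). In a
    strong semilattice a product of several factors may be computed in the
    component of the meet of their grades, just as for [F]
    ([strong_semilattice_extension]), so the glued operation reduces [F]. *)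

Set Implicit Arguments.
Unset Strict Implicit.
Unset Printing Implicit Defensive.

Import Order.TTheory.

(** * Iterated products in semigroups *)

Section SemigroupFolds.
Context (X : Type) (A : set X) (op : X -> X -> X).
Hypothesis op_semigroup : semigroup A op.

Lemma foldl_closed x s : A x -> all (mem A) s -> A (foldl op x s).
Proof.
case: op_semigroup => _ opA _; elim: s x => //= y s IH x Ax /andP[].
by rewrite inE => Ay As; apply: IH => //; apply: opA.
Qed.

Lemma op_foldl x y s : A x -> A y -> all (mem A) s ->
  op x (foldl op y s) = foldl op (op x y) s.
Proof.
case: op_semigroup => _ opA assoc Ax.
elim: s y => //= z s IH y Ay /andP[]; rewrite inE => Az As.
by rewrite IH //; [rewrite assoc | apply: opA].
Qed.

End SemigroupFolds.

Lemma foldl_nseq_idem (X : Type) (op : X -> X -> X) (e : X) k :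
  op e e = e -> foldl op e (nseq k e) = e.
Proof. by move=> ee; elim: k => //= k IH; rewrite ee. Qed.

Lemma nseqSr (X : Type) k (x : X) : nseq k.+1 x = rcons (nseq k x) x.
Proof. by elim: k => //= k <-. Qed.

Lemma all_mem_nseq (X : Type) (A : set X) k x : A x -> all (mem A) (nseq k x).
Proof. by move=> Ax; rewrite all_nseq /= (mem_set Ax) orbT. Qed.

Lemma mktuple_endsE (X : Type) n (x y z : X) :
  [tuple if i == 0 :> nat then x else if i == n.+1 :> nat then y else z
    | i < n.+2] = x :: rcons (nseq n z) y :> seq X.
Proof.
apply: (@eq_from_nth _ x); first by rewrite size_tuple/= size_rcons size_nseq.
move=> i; rewrite size_tuple => lti.
rewrite -[i]/(val (Ordinal lti)) -tnth_nth tnth_mktuple /=.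
case: i lti => //= i; rewrite !ltnS eqSS => lei.
rewrite nth_rcons size_nseq nth_nseq.
by move: lei; rewrite leq_eqVlt => /orP[/eqP->|lti];
  [rewrite eqxx ltnn | rewrite (ltn_eqF lti) lti].
Qed.

Lemma extension_foldl (X : Type) n (A : set X) (op : X -> X -> X)
    (F : n.-tuple X -> X) (t : n.-tuple X) x s :
  nary_extension A op F -> t = x :: s :> seq X -> all (mem A) (x :: s) ->
  F t = foldl op x s.
Proof.
move=> ext tE; rewrite -tE => /all_tnthP At.
suff : Some (foldl op x s) = Some (F t) by case.
by rewrite -(ext t) ?tE // => i; have := At i; rewrite inE.
Qed.

Lemma reduction_at_foldl (X : Type) n (A : set X) (op : X -> X -> X)
    (F : n.+2.-tuple X -> X) x y z :
  nary_extension A op F -> A x -> A y -> A z ->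
  reduction_at F z x y = op (foldl op x (nseq n z)) y.
Proof.
move=> ext Ax Ay Az; rewrite -foldl_rcons.
apply: (extension_foldl ext (mktuple_endsE _ _ _ _)).
by rewrite /= all_rcons all_mem_nseq //= !mem_set.
Qed.

(** * The binary reduction of an extension of an Abelian group *)

Section GroupReduction.
Context (X : Type) (n : nat) (A : set X) (F : n.+2.-tuple X -> X).
Context (op : X -> X -> X) (u : X).
Hypothesis op_group : abelian_group A op u.
Hypothesis op_exponent : exponent_divides A op u n.+1.
Hypothesis op_ext : nary_extension A op F.

Lemma foldl_exponent x y : A x -> A y -> foldl op x (nseq n.+1 y) = x.
Proof.
case: op_group => sg opC [Au op1] _ Ax Ay.
rewrite /= -(op_foldl sg) ?all_mem_nseq //.
by case: (op_exponent Ay) => ->; rewrite opC // op1.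
Qed.

Lemma reduction_at_left_unit x y : A x -> A y -> reduction_at F x x y = y.
Proof.
case: op_group => _ _ [_ op1] _ Ax Ay; rewrite (reduction_at_foldl op_ext) //.
by case: (op_exponent Ax) => ->; apply: op1.
Qed.

Lemma reduction_at_right_unit x y : A x -> A y -> reduction_at F y x y = x.
Proof.
move=> Ax Ay; rewrite (reduction_at_foldl op_ext) //.
by rewrite -foldl_rcons -nseqSr foldl_exponent.
Qed.

(** The [n] copies of [e] multiply to [e'], because the [n.+1]-st power of [e] is
    the unit. *)
Lemma reduction_at_inverse x y e e' : A x -> A y -> A e -> A e' ->
  op e e' = u -> reduction_at F e x y = op (op x e') y.
Proof.
case: op_group => sg opC [Au op1] _ Ax Ay Ae Ae' ee'.
case: (sg) => _ opA opassoc.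
rewrite (reduction_at_foldl op_ext) //; congr (op _ y).
have Az : A (foldl op x (nseq n e)).
  by apply: (foldl_closed sg) => //; apply: all_mem_nseq.
rewrite -[in RHS](foldl_exponent Ax Ae) nseqSr foldl_rcons.
by rewrite -opassoc // ee' opC // op1.
Qed.

Lemma foldl_op_right x y s : A x -> A y -> all (mem A) s ->
  op (foldl op x s) y = foldl op (op x y) s.
Proof.
case: op_group => sg opC _ _ Ax Ay As.
by rewrite opC ?(op_foldl sg) //; [rewrite opC | apply: (foldl_closed sg)].
Qed.

(** Each factor after the first brings in one copy of [e'], the inverse of [e],
    and commutativity collects these copies at the end. *)
Lemma foldl_reduction_at e e' x s : A e -> A e' -> op e e' = u -> A x ->
  all (mem A) s ->
  foldl (reduction_at F e) x s = foldl op (foldl op x s) (nseq (size s) e').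
Proof.
case: op_group => sg opC _ _ Ae Ae' ee'; case: (sg) => _ opA opassoc.
elim: s x => //= y s IH x Ax /andP[]; rewrite inE => Ay As.
have -> : reduction_at F e x y = op (op x y) e'.
  by rewrite (reduction_at_inverse Ax Ay Ae Ae' ee') -!opassoc // (opC e').
rewrite IH //; last by apply: (opA); [apply: opA|].
by rewrite -foldl_op_right //; apply: opA.
Qed.

(** With respect to [e], the operation is [x e^(-1) y]: a copy of the group with
    neutral element [e]. *)
Lemma reduction_at_semigroup_of_group e :
  A e -> semigroup A (reduction_at F e).
Proof.
case: op_group => sg opC _ inv Ae; case: (sg) => A0 opA opassoc.
have [e' Ae' ee'] := inv e Ae.
have rE x y : A x -> A y -> reduction_at F e x y = op (op x e') y.
  by move=> Ax Ay; rewrite (reduction_at_inverse Ax Ay Ae Ae').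
split=> // [x y Ax Ay|x y z Ax Ay Az].
  by rewrite rE //; do !apply: (opA).
by rewrite !rE // -?opassoc //; do !apply: (opA).
Qed.

Lemma reduction_at_extension_of_group e :
  A e -> nary_extension A (reduction_at F e) F.
Proof.
case: op_group => sg _ _ inv Ae t At; have [e' Ae' ee'] := inv e Ae.
have sz : size t = n.+2 by rewrite size_tuple.
have : all (mem A) t by apply/all_tnthP => i; rewrite inE; apply: At.
case tE : (tval t) sz => [//|x s] /= [sz] Axs.
rewrite (extension_foldl op_ext tE Axs).
move: Axs => /andP[]; rewrite inE => Ax As; congr Some.
rewrite (foldl_reduction_at Ae Ae' ee') // sz foldl_exponent //.
exact: (foldl_closed sg).
Qed.

End GroupReduction.

Section GroupExtension.
Context (X : Type) (n : nat) (A : set X) (F : n.+2.-tuple X -> X).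
Hypothesis F_group : extension_of_abelian_group_of_exponent_dvd A F.

Lemma reduction_at_left_id x y : A x -> A y -> reduction_at F x x y = y.
Proof.
by case: F_group => op [u [grp expo ext]]; apply: (reduction_at_left_unit grp).
Qed.

Lemma reduction_at_right_id x y : A x -> A y -> reduction_at F y x y = x.
Proof.
by case: F_group => op [u [grp expo ext]]; apply: (reduction_at_right_unit grp).
Qed.

Lemma reduction_at_semigroup e : A e -> semigroup A (reduction_at F e).
Proof.
case: F_group => op [u [grp expo ext]].
exact: (reduction_at_semigroup_of_group grp).
Qed.

Lemma reduction_at_extension e : A e -> nary_extension A (reduction_at F e) F.
Proof.
case: F_group => op [u [grp expo ext]].
exact: (reduction_at_extension_of_group grp).
Qed.

End GroupExtension.

Lemma reduction_at_morphism (X : Type) n (A B : set X) (F : n.+2.-tuple X -> X)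
    (f : X -> X) e :
  A e -> nary_morphism A B F f ->
  semigroup_morphism A B (reduction_at F e) (reduction_at F (f e)) f.
Proof.
move=> Ae [fAB fF]; split=> // x y Ax Ay; rewrite fF => [|i].
  congr F; apply: eq_from_tnth => i; rewrite tnth_map !tnth_mktuple.
  by do 2 case: ifP => // _.
by rewrite tnth_mktuple; do 2 case: ifP => // _.
Qed.

(** * Strong semilattices of semigroups *)

Section Grades.
Context (d : Order.disp_t) (Y : meetSemilatticeType d) (X : Type).
Context (X_ : Y -> set X).
Hypothesis X_partition : classical_sets.partition setT X_ setT.

Lemma grade_exists : exists g : X -> Y, forall x, X_ (g x) x.
Proof.
suff /choice[g Xg] : forall x, exists a, X_ a x by exists g.
move=> x; case: X_partition => cov _ _.
have : cover setT X_ x by rewrite cov.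
by move=> [a _ Xax]; exists a.
Qed.

Lemma grade_unique a b x : X_ a x -> X_ b x -> a = b.
Proof. by case: X_partition => _ triv _ Xa Xb; apply: triv => //; exists x. Qed.

Lemma foldl_meet_le (m : Y) a s :
  (m <= foldl Order.meet a s)%O = (m <= a)%O && all (>= m)%O s.
Proof. by elim: s a => /= [|b s IH] a; rewrite ?andbT // IH lexI andbA. Qed.

Lemma strong_semilattice_exists (G_ : Y -> X -> X -> X)
    (phi : Y -> Y -> X -> X) :
  (forall a, semigroup (X_ a) (G_ a)) ->
  (forall a b : Y, (b <= a)%O ->
     semigroup_morphism (X_ a) (X_ b) (G_ a) (G_ b) (phi a b)) ->
  functorial X_ phi -> exists G, strong_semilattice X_ G_ phi G.
Proof.
move=> sg morph func; have [g Xg] := grade_exists.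
exists (fun x y => let m := Order.meet (g x) (g y) in
                   G_ m (phi (g x) m x) (phi (g y) m y)).
split=> // a b x y Xa Xb.
by rewrite (grade_unique (Xg x) Xa) (grade_unique (Xg y) Xb).
Qed.

End Grades.

Section StrongSemilattice.
Context (d : Order.disp_t) (Y : meetSemilatticeType d) (X : Type).
Context (X_ : Y -> set X) (G_ : Y -> X -> X -> X) (phi : Y -> Y -> X -> X).
Context (G : X -> X -> X).
Hypothesis G_strong : strong_semilattice X_ G_ phi G.

Lemma ss_graded a b x y :
  X_ a x -> X_ b y -> X_ (Order.meet a b) (G x y).
Proof.
move=> Xa Xb; rewrite (ss_op G_strong Xa Xb).
have [_ closed _] := ss_semigroup G_strong (Order.meet a b).
have [fa _] := ss_morphism G_strong (leIl a b).
have [fb _] := ss_morphism G_strong (leIr b a).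
by apply: closed; [apply: fa | apply: fb].
Qed.

(** Products may be computed in any component below the factors: functoriality
    lets the transition from the component of the meet be made beforehand. *)
Lemma ss_transition_op a b p x y : X_ a x -> X_ b y ->
  (p <= a)%O -> (p <= b)%O ->
  phi (Order.meet a b) p (G x y) = G_ p (phi a p x) (phi b p y).
Proof.
move=> Xa Xb pa pb; rewrite (ss_op G_strong Xa Xb).
have pab : (p <= Order.meet a b)%O by rewrite lexI pa.
have [_ comp] := ss_functorial G_strong.
have [fa _] := ss_morphism G_strong (leIl a b).
have [fb _] := ss_morphism G_strong (leIr b a).
have [_ ->] := ss_morphism G_strong pab; [|exact: fa|exact: fb].
by rewrite !comp ?leIl ?leIr.
Qed.

Lemma strong_semilattice_semigroup :
  ([set: X] !=set0)%classic -> semigroup setT G.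
Proof.
have [g Xg] := grade_exists (ss_partition G_strong).
split=> // x y z _ _ _.
have [id_ comp] := ss_functorial G_strong.
move: (g x) (g y) (g z) (Xg x) (Xg y) (Xg z) => a b c Xx Xy Xz.
pose m := Order.meet a (Order.meet b c).
have mE : m = Order.meet (Order.meet a b) c by rewrite /m meetA.
have [ma mbc] : (m <= a)%O /\ (m <= Order.meet b c)%O by rewrite leIl leIr.
have [mb mc] : (m <= b)%O /\ (m <= c)%O.
  by move: mbc; rewrite lexI => /andP.
have mab : (m <= Order.meet a b)%O by rewrite lexI ma.
have Xyz : X_ (Order.meet b c) (G y z) by apply: ss_graded.
have Xxy : X_ (Order.meet a b) (G x y) by apply: ss_graded.
have -> : G x (G y z) = G_ m (phi a m x) (G_ m (phi b m y) (phi c m z)).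
  rewrite -(id_ m (G x _)); last exact: ss_graded.
  by rewrite !ss_transition_op.
have -> : G (G x y) z = G_ m (G_ m (phi a m x) (phi b m y)) (phi c m z).
  rewrite -(id_ m (G _ z)); last by rewrite mE; apply: ss_graded.
  by rewrite {1}mE !ss_transition_op.
have [_ _ assoc] := ss_semigroup G_strong m.
have phiX a' x' : (m <= a')%O -> X_ a' x' -> X_ m (phi a' m x').
  by move=> le; have [f _] := ss_morphism G_strong le; apply: f.
by apply: assoc; apply: phiX.
Qed.

Section Folds.
Context (g : X -> Y).
Hypothesis Xg : forall x, X_ (g x) x.

Lemma ss_foldl_graded x s :
  X_ (foldl Order.meet (g x) (map g s)) (foldl G x s).
Proof.
suff gen a : X_ a x -> X_ (foldl Order.meet a (map g s)) (foldl G x s).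
  exact: gen.
by elim: s x a => //= y s IH x a Xa; apply/IH/ss_graded.
Qed.

Lemma ss_transition_foldl p x s :
  (p <= foldl Order.meet (g x) (map g s))%O ->
  phi (foldl Order.meet (g x) (map g s)) p (foldl G x s) =
  foldl (G_ p) (phi (g x) p x) [seq phi (g y) p y | y <- s].
Proof.
suff gen a : X_ a x -> (p <= foldl Order.meet a (map g s))%O ->
    phi (foldl Order.meet a (map g s)) p (foldl G x s) =
    foldl (G_ p) (phi a p x) [seq phi (g y) p y | y <- s].
  exact: gen.
elim: s x a => //= y s IH x a Xa; rewrite foldl_meet_le => /andP[pay ps].
rewrite IH ?foldl_meet_le ?pay //; last exact: ss_graded.
by move: pay; rewrite lexI => /andP[pa py]; rewrite ss_transition_op.
Qed.

End Folds.

(** Both sides move all factors into the component of the meet of their grades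
    before multiplying, so it suffices that [G_] extends to [F] there. *)
Lemma strong_semilattice_extension n (F : n.+1.-tuple X -> X) :
  strong_nary_semilattice X_ phi F ->
  (forall a, nary_extension (X_ a) (G_ a) F) -> nary_extension setT G F.
Proof.
move=> F_strong ext t _.
have [g Xg] := grade_exists (ss_partition G_strong).
have [id_ _] := ss_functorial G_strong.
have := size_tuple t; case tE : (tval t) => [//|x s] _ /=.
set m := foldl Order.meet (g x) (map g s).
have gt : seq_product Order.meet (map_tuple g t) = Some m by rewrite /= tE.
have mle i : (m <= g (tnth t i))%O.
  have : all (>= m)%O (map g t).
    by rewrite tE /= -foldl_meet_le.
  by rewrite all_map => /all_tnthP/(_ i).
have Xt i : X_ (tnth (map_tuple g t) i) (tnth t i) by rewrite tnth_map.
rewrite (sns_op F_strong gt Xt); set t' := mktuple _.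
have t'E : t' = phi (g x) m x :: [seq phi (g y) m y | y <- s] :> seq X.
  suff -> : t' = map_tuple (fun y => phi (g y) m y) t by rewrite /= tE.
  by apply: eq_from_tnth => i; rewrite tnth_mktuple !tnth_map.
rewrite (extension_foldl (ext m) t'E); last first.
  rewrite -t'E; apply/all_tnthP => i; rewrite inE tnth_mktuple tnth_map.
  by have [f _] := ss_morphism G_strong (mle i); apply: f.
by rewrite -ss_transition_foldl // id_ //; apply: ss_foldl_graded.
Qed.

End StrongSemilattice.

(** * Idempotents of a reduction *)

Section StrongNary.
Context (d : Order.disp_t) (Y : meetSemilatticeType d) (X : Type) (n : nat).
Context (F : n.+2.-tuple X -> X) (X_ : Y -> set X) (phi : Y -> Y -> X -> X).
Hypothesis F_strong : strong_nary_semilattice X_ phi F.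

(** An upper bound [c] of the meet of the two ends is absorbed. This covers the
    two cases of interest, [c = a] and [c = b], at once. *)
Lemma seq_product_meet_ends (a b c : Y) : (Order.meet a b <= c)%O ->
  seq_product Order.meet
    [tuple if i == 0 :> nat then a else if i == n.+1 :> nat then b else c
      | i < n.+2] = Some (Order.meet a b).
Proof.
move=> abc; rewrite mktuple_endsE /= foldl_rcons; congr Some.
suff gen k a' : Order.meet a' b = Order.meet a b ->
    Order.meet (foldl Order.meet a' (nseq k c)) b = Order.meet a b.
  exact: gen.
elim: k a' => //= k IH a' a'b.
by apply: IH; rewrite meetAC a'b; apply/meet_idPl.
Qed.

Lemma reduction_at_graded a b c x y z : X_ a x -> X_ b y -> X_ c z ->
  (Order.meet a b <= c)%O -> X_ (Order.meet a b) (reduction_at F z x y).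
Proof.
move=> Xa Xb Xc abc.
apply: (sns_graded F_strong (seq_product_meet_ends abc)) => i.
by rewrite !tnth_mktuple; do 2 case: ifP => // _.
Qed.

Lemma reduction_at_transition a b c x y z : X_ a x -> X_ b y -> X_ c z ->
  (Order.meet a b <= c)%O -> let m := Order.meet a b in
  reduction_at F z x y = reduction_at F (phi c m z) (phi a m x) (phi b m y).
Proof.
move=> Xa Xb Xc abc m.
rewrite {1}/reduction_at (sns_op F_strong (seq_product_meet_ends abc)) => [|i].
  congr F; apply: eq_from_tnth => i; rewrite !tnth_mktuple.
  by do 2 case: ifP => // _.
by rewrite !tnth_mktuple; do 2 case: ifP => // _.
Qed.

Context (op : X -> X -> X).
Hypothesis op_reduction : is_reduction op F.

Lemma reduction_at_left_idem e y : op e e = e -> reduction_at F e e y = op e y.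
Proof.
case: op_reduction => _ ext ee.
by rewrite (reduction_at_foldl ext) // foldl_nseq_idem.
Qed.

Lemma reduction_at_right_power x y :
  reduction_at F y x y = op x (foldl op y (nseq n y)).
Proof.
case: op_reduction => sg ext.
rewrite (reduction_at_foldl ext) // -foldl_rcons -nseqSr /=.
by rewrite (op_foldl sg) ?all_mem_nseq.
Qed.

Lemma reduction_at_right_idem x f : op f f = f -> reduction_at F f x f = op x f.
Proof. by move=> ff; rewrite reduction_at_right_power foldl_nseq_idem. Qed.

(** For [e = x^(n-1)], the equation [e x = x] puts the grade of [x] below that
    of [e], and [F (e, x, ..., x) = e e = e] puts the grade of [e] below that
    of [x]. *)
Lemma component_has_idempotent a : nary_idempotent F ->
  exists e, X_ a e /\ op e e = e.
Proof.
move=> F_idem; case: (op_reduction) => sg ext.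
have [cov _ /(_ a Logic.I) [x Xx]] := sns_partition F_strong.
pose e := foldl op x (nseq n x).
have ex : op e x = x.
  rewrite -foldl_rcons -nseqSr -[RHS]F_idem; symmetry.
  by apply: (extension_foldl ext) => //; apply: (@all_mem_nseq _ _ n.+2).
have ee : op e e = e by rewrite (op_foldl sg) ?all_mem_nseq // ex.
have [g Xg] := grade_exists (sns_partition F_strong).
have uniq_ := grade_unique (sns_partition F_strong).
have ge : g e = Order.meet (g e) a.
  apply: (uniq_ _ _ e) => //; rewrite -{2}ee -reduction_at_right_power.
  exact: (reduction_at_graded (Xg e) Xx Xx (leIr _ _)).
have ga : a = Order.meet (g e) a.
  apply: (uniq_ _ _ x) => //; rewrite -ex -reduction_at_left_idem //.
  exact: (reduction_at_graded (Xg e) Xx (Xg e) (leIl _ _)).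
by exists e; split=> //; rewrite ga -ge.
Qed.

(** Both [F (e, ..., e, f)] and [F (e, f, ..., f)] equal [op e f]; in the group
    [X_ b] the repeated argument has trivial [n.+1]-st power,
    so that only the other argument, [f] resp. [phi a b e], remains. *)
Lemma transition_idempotent a b e f :
  (forall a, extension_of_abelian_group_of_exponent_dvd (X_ a) F) ->
  (b <= a)%O -> X_ a e -> X_ b f -> op e e = e -> op f f = f -> phi a b e = f.
Proof.
move=> F_groups ba Xe Xf ee ff.
have mE : Order.meet a b = b by apply/meet_idPr.
have [id_ _] := sns_functorial F_strong.
have [fab _] := sns_morphism F_strong ba; have Xphi := fab _ Xe.
have <- : op e f = f.
  rewrite -reduction_at_left_idem //.
  rewrite (reduction_at_transition Xe Xf Xe) ?leIl // mE (id_ b f) //.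
  exact: (reduction_at_left_id (F_groups b)).
rewrite -reduction_at_right_idem //.
rewrite (reduction_at_transition Xe Xf Xf) ?leIr // mE (id_ b f) //.
by rewrite (reduction_at_right_id (F_groups b)).
Qed.

End StrongNary.

(** * The characterization of reducibility *)

Theorem proposition5p3 (n : nat) (n_ge2 : 2 <= n)
    (d : Order.disp_t) (Y : meetSemilatticeType d) (X : Type)
    (F : n.-tuple X -> X) (X_ : Y -> set X) (phi : Y -> Y -> X -> X)
    (F_band : symmetric_nary_band F)
    (F_strong : strong_nary_semilattice X_ phi F)
    (F_groups : forall a : Y, extension_of_abelian_group_of_exponent_dvd (X_ a) F) :
  (reducible F <->
     exists e : Y -> X,
       (forall a : Y, X_ a (e a)) /\
       (forall a b : Y, (b <= a)%O -> phi a b (e a) = e b)) /\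
  (forall e : Y -> X,
     (forall a : Y, X_ a (e a)) ->
     (forall a b : Y, (b <= a)%O -> phi a b (e a) = e b) ->
     exists G : X -> X -> X,
       strong_semilattice X_ (fun a : Y => reduction_at F (e a)) phi G /\
       is_reduction G F).
Proof.
case: n n_ge2 F F_band F_strong F_groups => [|[|n]] // _ F.
move=> [[X0 _ _] _ F_idem] F_strong F_groups.
have reduction_of_section (e : Y -> X) :
    (forall a : Y, X_ a (e a)) ->
    (forall a b : Y, (b <= a)%O -> phi a b (e a) = e b) ->
    exists G : X -> X -> X,
      strong_semilattice X_ (fun a : Y => reduction_at F (e a)) phi G /\
      is_reduction G F.
  move=> Xe phie.
  have [|a b ba||G G_strong] :=
      @strong_semilattice_exists _ _ _ _ (sns_partition F_strong)
        (fun a => reduction_at F (e a)) phi.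
  - by move=> a; apply: (reduction_at_semigroup (F_groups a)).
  - rewrite -(phie a b ba); apply: reduction_at_morphism => //.
    exact: (sns_morphism F_strong).
  - exact: (sns_functorial F_strong).
  - exists G; split=> //; split; first exact: (strong_semilattice_semigroup G_strong).
    apply: (strong_semilattice_extension G_strong F_strong) => a.
    exact: (reduction_at_extension (F_groups a)).
split=> //; split=> [[op op_red]|[e [Xe phie]]]; last first.
  by have [G [_ G_red]] := reduction_of_section e Xe phie; exists G.
have /choice[e Xe] : forall a, exists e, X_ a e /\ op e e = e.
  by move=> a; apply: (component_has_idempotent F_strong).
exists e; split=> [a|a b ba]; first by have [] := Xe a.
have [[Xa ea] [Xb eb]] := (Xe a, Xe b).
exact: (transition_idempotent F_strong op_red).
Qed.
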